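(* Let $\mathbb K$ be a field of characteristic zero, let $A$ be a finitely generated commutative $\mathbb K$-algebra, and let $\mathfrak h\subseteq\operatorname{Der}_{\mathbb K}(A)$ be a solvable Lie algebra generated by finitely many locally finite Lie subalgebras $\mathfrak h_i\subseteq\operatorname{Der}_{\mathbb K}(A)$. Then $\mathfrak h$ is finite-dimensional and acts locally finitely on $A$.
   Context: Algebras are commutative, associative and unital. $\operatorname{Der}_{\mathbb K}(A)$ is the Lie algebra of $\mathbb K$-linear derivations of $A$. A Lie subalgebra $L\subseteq\operatorname{Der}_{\mathbb K}(A)$ is called locally finite (on $A$), or is said to act locally finitely on $A$, if every $a\in A$ is contained in some finite-dimensional subspace $U\subseteq A$ with $D(U)\subseteq U$ for all $D\in L$. *)

(* Defs.v *)
From HB Require Import structures.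
From mathcomp Require Import all_boot all_order all_algebra.
From mathcomp Require Import boolp classical_sets functions.

Set Implicit Arguments.
Unset Strict Implicit.
Unset Printing Implicit Defensive.

Import GRing.Theory.
Local Open Scope classical_set_scope.
Local Open Scope ring_scope.

(* [comAlgType K] requires [1 != 0].  So that the zero algebra is allowed too, a
   commutative [K]-algebra is taken here as a commutative ring with a structure
   morphism [algmap] from [K], acting by [k *: x = algmap k * x]. *)
Record comPzAlgType (K : fieldType) := ComPzAlg {
  alg_ring : comPzRingType;
  algmap : {rmorphism K -> alg_ring}
}.

Definition alg_sort (K : fieldType) (A : comPzAlgType K) : Type := alg_ring A.
Coercion alg_sort : comPzAlgType >-> Sortclass.

HB.instance Definition _ (K : fieldType) (A : comPzAlgType K) :=
  GRing.ComPzRing.on (alg_sort A).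

Section ScalarAction.
Variables (K : fieldType) (A : comPzAlgType K).

Let scale (k : K) (x : A) : A := algmap A k * x.

Let scaleA k l x : scale k (scale l x) = scale (k * l) x.
Proof. by rewrite /scale rmorphM mulrA. Qed.

Let scale1 : left_id 1 scale.
Proof. by move=> x; rewrite /scale rmorph1 mul1r. Qed.

Let scaleDr : right_distributive scale +%R.
Proof. by move=> k x y; rewrite /scale mulrDr. Qed.

Let scaleDl x : {morph scale^~ x : k l / k + l}.
Proof. by move=> k l; rewrite /scale rmorphD mulrDl. Qed.

HB.instance Definition _ :=
  GRing.Zmodule_isLmodule.Build K (alg_sort A) scaleA scale1 scaleDr scaleDl.

Lemma algmapE (k : K) (x : A) : k *: x = (algmap A k : A) * x.
Proof. by []. Qed.

End ScalarAction.

Definition comPzAlg_of (K : fieldType) (A : comAlgType K) : comPzAlgType K :=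
  ComPzAlg (in_alg A).

Lemma comPzAlg_ofE (K : fieldType) (A : comAlgType K) (k : K) (x : A) :
  k *: (x : comPzAlg_of A) = k *: x.
Proof. exact: mulr_algl. Qed.

Section Subspaces.
Variables (K : fieldType) (V : lmodType K).

Definition subspace (U : set V) : Prop :=
  U 0 /\ forall (k : K) (u v : V), U u -> U v -> U (k *: u + v).

Definition lspan (X : set V) : set V := smallest subspace X.

Definition finite_dim (U : set V) : Prop :=
  exists s : seq V, U = lspan [set` s].

End Subspaces.

Section Algebras.
Variables (K : fieldType) (A : comPzAlgType K).

Definition subalgebra (S : set A) : Prop :=
  [/\ S 1, subspace S & forall x y : A, S x -> S y -> S (x * y)].

Definition finitely_generated : Prop :=
  exists s : seq A, smallest subalgebra [set` s] = setT.

End Algebras.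

Section Derivations.
Variables (K : fieldType) (A : comPzAlgType K).

(* [A -> A] is a [K]-vector space for the pointwise operations, which is what
   [subspace], [lspan], [finite_dim] and [0] refer to on sets of derivations. *)
Definition Der : set (A -> A) :=
  [set D : A -> A | linear D /\ forall a b : A, D (a * b) = D a * b + a * D b].

Definition lie (D E : A -> A) : A -> A := fun a => D (E a) - E (D a).

Definition lie_subalgebra (L : set (A -> A)) : Prop :=
  [/\ L `<=` Der, subspace L & forall D E, L D -> L E -> L (lie D E)].

Definition lie_generated (X : set (A -> A)) : set (A -> A) :=
  smallest lie_subalgebra X.

Definition derived (L : set (A -> A)) : set (A -> A) :=
  lspan [set lie D E | D in L & E in L].

Definition lie_solvable (L : set (A -> A)) : Prop :=
  exists n : nat, iter n derived L = [set 0].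

Definition locally_finite (L : set (A -> A)) : Prop :=
  forall a : A, exists U : set A,
    [/\ subspace U, finite_dim U, U a & forall D, L D -> D @` U `<=` U].

End Derivations.

(* Main.v *)
From HB Require Import structures.
Require Import Defs.
From mathcomp Require Import all_boot all_order all_algebra.
From mathcomp Require Import boolp classical_sets functions.

Set Implicit Arguments.
Unset Strict Implicit.
Unset Printing Implicit Defensive.

Import GRing.Theory.
Local Open Scope classical_set_scope.
Local Open Scope ring_scope.

(** The theorem rests on a fact about operators that needs neither solvability
    nor an algebra (lemma [locfin_brackets]): in characteristic zero, a
    finite-dimensional Lie algebra [g] of operators on a vector space [M] acts
    locally finitely as soon as it is generated by locally finite operators.

    Filter the associative algebra generated by [g] by word length. Its
    associated graded ring is commutative, since a commutator of two elements of
    [g] is again in [g] and so shortens a word. For a finite-dimensional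
    subspace [V] of [M], the operators that agree on [V] with a shorter one
    give an ideal [J_V] of the graded ring (the predicate [symb]). Call [z] in
    [g] integral if it lies in the radical of [J_V] for every [V]. A locally
    finite [x] is integral (lemma [integral_locfin]). If [x] is locally finite and
    [z] is integral, then so is the bracket of [x] and [z]: enlarge [V] to be
    stable under [x]; then [J_V] is stable under the derivation [ad x], and in
    characteristic zero so is its radical (lemma [integral_comm]). The iterated
    brackets of the generators span [g], so [g] has a finite spanning list of
    integral elements. By the pigeonhole principle every long word in that list
    contains a high power of one of them, hence agrees on [V] with a shorter word
    (lemma [symb_high_order]); so words of bounded length applied to [V] give a
    finite-dimensional stable space.

    This fact is used twice. The first use, with the adjoint action, shows that
    [h] is finite-dimensional, by proving that each term [I] of the derived series
    has finite codimension in [h] (lemma [finite_codim_derived]). On [I / [I, I]]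
    the ideal [I] acts trivially, so [h] acts through a finite-dimensional Lie
    algebra; it is generated by locally finite operators, because a locally finite
    derivation [x] of a finitely generated algebra has [ad x] locally finite (lemma
    [ad_locally_finite]). Hence [I / [I, I]] is a locally finite [h]-module. As
    [h] is a finitely generated Lie algebra, this module is finitely generated,
    and so finite-dimensional. Solvability makes the series reach zero. The
    second use, with [h] acting on [A] itself, is the local finiteness claimed. *)

(** * Subspaces and finite dimension *)

Section LinearMaps.
Variables (K : fieldType) (V W : lmodType K) (f : V -> W).
Hypothesis fL : linear f.

Lemma linD u v : f (u + v) = f u + f v.
Proof. by rewrite -[u]scale1r fL !scale1r. Qed.

Lemma lin0 : f 0 = 0.
Proof. by apply: (addrI (f 0)); rewrite -linD !addr0. Qed.

Lemma linZ k u : f (k *: u) = k *: f u.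
Proof. by rewrite -[k *: u]addr0 fL lin0 addr0. Qed.

Lemma linN u : f (- u) = - f u.
Proof. by rewrite -scaleN1r linZ scaleN1r. Qed.

Lemma linB u v : f (u - v) = f u - f v.
Proof. by rewrite linD linN. Qed.

End LinearMaps.

Lemma linear_comb (K : fieldType) (V W : lmodType K) (k : K) (f g : V -> W) :
  linear f -> linear g -> linear (k *: f + g).
Proof.
move=> fL gL c u v; rewrite !fctE fL gL !scalerDr !scalerA addrACA.
by rewrite (mulrC k).
Qed.

Section Subspaces.
Variables (K : fieldType) (V : lmodType K).
Implicit Types (U W : set V) (X : set V) (s t : seq V).

Lemma subspace0 U : subspace U -> U 0.
Proof. by case. Qed.

Lemma subspaceP U k u v : subspace U -> U u -> U v -> U (k *: u + v).
Proof. by case=> _; apply. Qed.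

Lemma subspaceD U u v : subspace U -> U u -> U v -> U (u + v).
Proof. by move=> sU Uu Uv; rewrite -[u]scale1r; apply: subspaceP. Qed.

Lemma subspaceZ U k u : subspace U -> U u -> U (k *: u).
Proof.
by move=> sU Uu; rewrite -[k *: u]addr0; apply: subspaceP => //; case: sU.
Qed.

Lemma subspaceB U u v : subspace U -> U u -> U v -> U (u - v).
Proof.
by move=> sU Uu Uv; rewrite -scaleN1r addrC; apply: subspaceP.
Qed.

Lemma subspaceI U W : subspace U -> subspace W -> subspace (U `&` W).
Proof.
move=> sU sW; split; first by split; apply: subspace0.
by move=> k u v [Uu Wu] [Uv Wv]; split; apply: subspaceP.
Qed.

Lemma subspace_lspan X : subspace (lspan X).
Proof.
split; first by move=> U [[U0 _] _].
move=> k u v Xu Xv U UP; apply: subspaceP; [by case: UP | exact: Xu|exact: Xv].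
Qed.

Lemma sub_lspan X : X `<=` lspan X.
Proof. exact: sub_gen_smallest. Qed.

Lemma lspan_min X U : subspace U -> X `<=` U -> lspan X `<=` U.
Proof. exact: smallest_sub. Qed.

Lemma lspan_mono X (Y : set V) : X `<=` Y -> lspan X `<=` lspan Y.
Proof.
by move=> XY; apply: lspan_min; [exact: subspace_lspan | move=> x /XY/sub_lspan].
Qed.

Lemma mem_lspan s v : v \in s -> lspan [set` s] v.
Proof. by move=> sv; apply: sub_lspan. Qed.

Lemma lspan_nil v : lspan [set` ([::] : seq V)] v -> v = 0.
Proof.
move=> h; apply: (@lspan_min [set` ([::] : seq V)] [set 0]) h => //.
by split=> // k u w -> ->; rewrite scaler0 addr0.
Qed.

Lemma lspan_cons a s v : lspan [set` (a :: s)] v ->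
  exists k u, lspan [set` s] u /\ v = k *: a + u.
Proof.
have sS := subspace_lspan [set` s].
apply: (@lspan_min [set` (a :: s)]
  [set v | exists k u, lspan [set` s] u /\ v = k *: a + u]).
  split; first by exists 0, 0; rewrite scale0r addr0; split=> //; case: sS.
  move=> k _ _ [c [u [Su ->]]] [d [w [Sw ->]]].
  exists (k * c + d), (k *: u + w); split; first exact: (subspaceP _ sS).
  by rewrite scalerDr scalerA scalerDl addrACA.
move=> x /=; rewrite inE => /orP[/eqP ->|xs].
  by exists 1, 0; split; [case: sS | rewrite scale1r addr0].
by exists 0, x; split; [apply: mem_lspan | rewrite scale0r add0r].
Qed.

End Subspaces.

Lemma lspan_lin (K : fieldType) (V W : lmodType K) (f : V -> W)
    (X : set V) (U : set W) :
  linear f -> subspace U -> (forall v, X v -> U (f v)) ->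
  forall v, lspan X v -> U (f v).
Proof.
move=> fL sU XU; apply: lspan_min => //.
split; first by rewrite /= lin0 //; case: sU.
by move=> k u v /= Uu Uv; rewrite fL; apply: subspaceP.
Qed.

(** Elimination, one vector of [t] at a time: if some [w0] in [W] has a nonzero
    coordinate along the first vector of [t], then subtracting multiples of [w0]
    kills that coordinate on all of [W]. *)
Lemma finite_mod_ker (K : fieldType) (V V' : lmodType K) (f : V -> V')
    (W : set V) (t : seq V') :
  linear f -> subspace W -> (forall w, W w -> lspan [set` t] (f w)) ->
  exists us : seq V, (forall u, u \in us -> W u) /\
    forall w, W w -> exists2 u, lspan [set` us] u & f w = f u.
Proof.
move=> fL; elim: t W => [|a t IH] W sW Wt.
  exists [::]; split=> // w /Wt/lspan_nil ->; exists 0; last by rewrite lin0.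
  exact: subspace0 (subspace_lspan _).
set W' := [set w | W w /\ lspan [set` t] (f w)].
have sS := subspace_lspan [set` t].
have sW' : subspace W'.
  split; first by rewrite /W' /= lin0 //; split; apply: subspace0.
  by move=> k u v [Wu tu] [Wv tv]; split; [|rewrite fL];
    [exact: (subspaceP _ sW) | exact: (subspaceP _ sS)].
have [us [usW usP]] := IH W' sW' (fun w => @proj2 _ _).
have [WW'|] := pselect (W `<=` W').
  by exists us; split=> [u /usW[]|w /WW'/usP].
move/existsNP=> [w0 /not_implyP [Ww0 nW'w0]].
have [c [r [tr fw0]]] := lspan_cons (Wt _ Ww0).
have c0 : c != 0.
  apply/eqP => c0; apply: nW'w0; split=> //.
  by rewrite fw0 c0 scale0r add0r.
exists (w0 :: us); split=> [u|w Ww].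
  by rewrite inE => /orP[/eqP -> //|/usW []].
have [d [q [tq fw]]] := lspan_cons (Wt _ Ww).
have [|u usu fu] := usP (w - (d / c) *: w0).
  split; first by apply: subspaceB => //; apply: subspaceZ.
  rewrite linB // linZ // fw fw0 scalerDr scalerA divfK // opprD addrACA subrr.
  by rewrite add0r; apply: (subspaceB sS) => //; apply: (subspaceZ _ sS).
exists ((d / c) *: w0 + u).
  apply: (subspaceP _ (subspace_lspan _)).
    by apply: mem_lspan; rewrite mem_head.
  by apply: lspan_mono usu => x /= xs; rewrite inE xs orbT.
by rewrite linD // -fu -linD // addrC subrK.
Qed.

Section FiniteDimension.
Variables (K : fieldType) (V : lmodType K).
Implicit Types (U W : set V) (s t : seq V).

Lemma finite_dim_sub W t : subspace W -> W `<=` lspan [set` t] -> finite_dim W.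
Proof.
move=> sW Wt.
have [|us [usW usP]] := @finite_mod_ker _ _ _ (@id V) W t _ sW Wt; first by [].
exists us; apply/seteqP; split; first by move=> w /usP [u usu ->].
exact: lspan_min.
Qed.

(** Each vector of a finite list spanning [lspan X] involves only finitely many
    members of [X]. *)
Lemma finite_dim_gen (X : set V) t : lspan X `<=` lspan [set` t] ->
  exists2 s : seq V, (forall x, x \in s -> X x) & lspan X = lspan [set` s].
Proof.
move=> /(finite_dim_sub (subspace_lspan X)) [s Xs].
have [s' s'X ss'] : exists2 s' : seq V, (forall x, x \in s' -> X x) &
    forall x, x \in s -> lspan [set` s'] x.
  have: forall x, x \in s -> lspan X x by move=> x /mem_lspan; rewrite -Xs.
  elim: s {Xs} => [|a s IH] sX; first by exists [::].
  have [s1 s1X ss1] : exists2 s1 : seq V, (forall x, x \in s1 -> X x) &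
      forall x, x \in s -> lspan [set` s1] x.
    by apply: IH => x xs; apply: sX; rewrite inE xs orbT.
  have [s2 s2X s2a] : exists2 s2 : seq V, (forall x, x \in s2 -> X x) &
      lspan [set` s2] a.
    apply: (@lspan_min _ _ X [set a | exists2 s2 : seq V,
      (forall x, x \in s2 -> X x) & lspan [set` s2] a]); last first.
    - by apply: sX; rewrite mem_head.
    - move=> x Xx; exists [:: x]; last by apply: mem_lspan; rewrite mem_head.
      by move=> y; rewrite inE => /eqP ->.
    split; first by exists [::] => //; apply: subspace0; apply: subspace_lspan.
    move=> k u v [p pX pu] [q qX qv]; exists (p ++ q).
      by move=> x; rewrite mem_cat => /orP[/pX|/qX].
    apply: (subspaceP _ (subspace_lspan _)).
      by apply: lspan_mono pu => x /= xs; rewrite mem_cat xs.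
    by apply: lspan_mono qv => x /= xs; rewrite mem_cat xs orbT.
  exists (s2 ++ s1); first by move=> x; rewrite mem_cat => /orP[/s2X|/s1X].
  move=> x; rewrite inE => /orP[/eqP ->|/ss1].
    by apply: lspan_mono s2a => y /= ys; rewrite mem_cat ys.
  by apply: lspan_mono => y /= ys; rewrite mem_cat ys orbT.
exists s' => //; apply/seteqP; split; last first.
  by apply: lspan_mono => x /= /s'X.
rewrite Xs; apply: lspan_min => //; exact: subspace_lspan.
Qed.

Lemma subspace_sum U W : subspace U -> subspace W ->
  subspace [set v | exists u w, [/\ U u, W w & v = u + w]].
Proof.
move=> sU sW; split; first by exists 0, 0; rewrite addr0; split=> //; apply: subspace0.
move=> k _ _ [u [w [Uu Ww ->]]] [u' [w' [Uu' Ww' ->]]].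
exists (k *: u + u'), (k *: w + w'); split; try exact: subspaceP.
by rewrite scalerDr addrACA.
Qed.

End FiniteDimension.

Lemma subspace_image (K : fieldType) (V W : lmodType K) (f : V -> W) (U : set V) :
  linear f -> subspace U -> subspace (f @` U).
Proof.
move=> fL sU; split; first by exists 0; [apply: subspace0 | rewrite lin0].
by move=> k _ _ [u Uu <-] [v Uv <-]; exists (k *: u + v);
  [apply: subspaceP | rewrite fL].
Qed.

(** Applying elimination at each of the points [ps] in turn: functions that are
    determined by finitely many values in a finite-dimensional space form a
    finite-dimensional space. *)
Lemma finite_mod_values (K : fieldType) (T : eqType) (M : lmodType K)
    (W : set (T -> M)) (ps : seq T) (t : seq M) :
  subspace W -> (forall w p, W w -> p \in ps -> lspan [set` t] (w p)) ->
  exists us : seq (T -> M), (forall u, u \in us -> W u) /\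
    forall w, W w -> exists2 u, lspan [set` us] u & forall p, p \in ps -> w p = u p.
Proof.
elim: ps W => [|p ps IH] W sW Wt.
  exists [::]; split=> // w Ww; exists 0 => //.
  exact: subspace0 (subspace_lspan _).
have evL (q : T) : linear (fun w : T -> M => w q) by [].
have [w Ww|us [usW usP]] := finite_mod_ker (t := t) (evL p) sW.
  by apply: Wt => //; rewrite mem_head.
have sW0 : subspace [set w | W w /\ w p = 0].
  split; first by split=> //; apply: subspace0.
  move=> k u v [Wu up] [Wv vp]; split; first exact: subspaceP.
  by rewrite !fctE up vp scaler0 addr0.
have [w q [Ww _] qps|us' [us'W us'P]] := IH _ sW0.
  by apply: Wt => //; rewrite inE qps orbT.
exists (us ++ us'); split=> [u|w Ww].
  by rewrite mem_cat => /orP[/usW|/us'W []].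
have [u usu wu] := usP w Ww.
have Wu : W u by apply: lspan_min usu.
have [|u' us'u' wu'] := us'P (w - u).
  by split; [apply: subspaceB | rewrite !fctE wu subrr].
have u'p : u' p = 0.
  have : lspan [set w | W w /\ w p = 0] u' by apply: lspan_mono us'u'.
  by move/(lspan_min sW0 (fun x h => h)) => [].
exists (u + u').
  apply: (subspaceD (subspace_lspan _)).
    by apply: lspan_mono usu => x /= xs; rewrite mem_cat xs.
  by apply: lspan_mono us'u' => x /= xs; rewrite mem_cat xs orbT.
move=> q; rewrite inE => /orP[/eqP ->|/wu' e].
  by rewrite !fctE u'p addr0.
by rewrite !fctE -e !fctE addrC subrK.
Qed.

(** * Words in operators, filtered by length *)

(** For operators on an algebra this is the bracket [lie]. *)
Definition comm (M : zmodType) (x y : M -> M) : M -> M :=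
  fun v => x (y v) - y (x v).
Arguments comm {M} x y v.

Section Commutators.
Variables (K : fieldType) (M : lmodType K).
Implicit Types x y z : M -> M.

Lemma linear_id : linear (@id M).
Proof. by []. Qed.

Lemma linear_0 : linear (0 : M -> M).
Proof. by move=> k u v; rewrite -[RHS]/(k *: 0 + 0) scaler0 addr0. Qed.

Lemma linear_comp x y : linear x -> linear y -> linear (x \o y).
Proof. by move=> xL yL k u v; rewrite /= yL xL. Qed.

Lemma linear_comm x y : linear x -> linear y -> linear (comm x y).
Proof.
move=> xL yL k u v; rewrite /comm yL xL xL yL.
by rewrite scalerBr opprD addrACA.
Qed.

Lemma comm_linear_r x : linear x -> linear (comm x : (M -> M) -> (M -> M)).
Proof.
move=> xL k y z; apply/funext => v.
by rewrite /comm !fctE xL scalerBr opprD addrACA.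
Qed.

Lemma comm_linear_l x : linear x -> linear (comm^~ x : (M -> M) -> (M -> M)).
Proof.
move=> xL k y z; apply/funext => v.
by rewrite /comm !fctE xL scalerBr opprD addrACA.
Qed.

Lemma commC x y : comm x y = - comm y x.
Proof. by apply/funext => v; rewrite /comm !fctE opprB. Qed.

Lemma comm0 x : linear x -> comm x 0 = 0.
Proof. by move=> xL; rewrite lin0 //; apply: comm_linear_r. Qed.

Lemma comm_id x : comm x id = 0.
Proof. by apply/funext => v; rewrite /comm subrr. Qed.

Lemma comm_comp_r x y z : linear y ->
  comm x (y \o z) = (comm x y \o z) + (y \o comm x z).
Proof.
move=> yL; apply/funext => v; rewrite /comm !fctE /= (linB yL).
by rewrite addrA subrK.
Qed.

Lemma comm_comp_l x y z : linear x ->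
  comm (x \o y) z = (x \o comm y z) + (comm x z \o y).
Proof.
move=> xL; apply/funext => v; rewrite /comm !fctE /= (linB xL).
by rewrite addrA subrK.
Qed.

Lemma comm_jacobi x y z : linear x -> linear y -> linear z ->
  comm (comm x y) z = comm x (comm y z) - comm y (comm x z).
Proof.
move=> xL yL zL; apply/funext => v; rewrite /comm !fctE (linB xL) (linB yL) (linB zL).
set a := x (y (z v)); set b := y (x (z v)); set c := z (x (y v)).
set d := z (y (x v)); set e := x (z (y v)); set f := y (z (x v)).
rewrite !opprB !addrA [RHS](ACl (1*8*3*6*((4*7)*(2*5)))%AC) /=.
by rewrite (addrC (- f)) (addrC (- e)) !subrr !addr0.
Qed.

End Commutators.

Section Filtration.
Variables (K : fieldType) (M : lmodType K) (zs : seq (M -> M)).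
Hypothesis zsL : forall z, z \in zs -> linear z.
Hypothesis zsbr : forall z w, z \in zs -> w \in zs -> lspan [set` zs] (comm z w).
Implicit Types u v w x y z : M -> M.

Inductive ord : nat -> set (M -> M) :=
| ord_0 n : ord n 0
| ord_lin n k u v : ord n u -> ord n v -> ord n (k *: u + v)
| ord_id n : ord n id
| ord_mul n z u : z \in zs -> ord n u -> ord n.+1 (z \o u).

(** With the value [[set 0]] at [0], [ord n] modulo [ltord n] is in every degree
    the homogeneous part of the associated graded ring. *)
Definition ltord n : set (M -> M) := if n is n'.+1 then ord n' else [set 0].

Lemma subspace_ord n : subspace (ord n).
Proof. by split=> [|k u v]; [exact: ord_0 | exact: ord_lin]. Qed.

Lemma subspace_ltord n : subspace (ltord n).
Proof.
case: n => [|n]; last exact: subspace_ord.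
by split=> // k u v -> ->; rewrite scaler0 addr0.
Qed.

Lemma ord_linear n u : ord n u -> linear u.
Proof.
elim=> {n u} [n|n k u v _ uL _ vL|n|n z u zz _ uL].
- exact: linear_0.
- exact: linear_comb.
- exact: linear_id.
- by apply: linear_comp => //; apply: zsL.
Qed.

Lemma ord_mono n m u : (n <= m)%N -> ord n u -> ord m u.
Proof.
move=> nm nu; elim: nu m nm => {n u} [n|n k u v _ IHu _ IHv|n|n z u zz _ IHu] m nm.
- exact: ord_0.
- by apply: ord_lin; [apply: IHu | apply: IHv].
- exact: ord_id.
- by case: m nm => // m nm; apply: ord_mul => //; apply: IHu.
Qed.

Lemma ltord_mono n m u : (n <= m)%N -> ltord n u -> ltord m u.
Proof.
case: n => [_ ->|n]; first exact: subspace0 (subspace_ltord m).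
by case: m => // m nm; exact: (@ord_mono n m).
Qed.

Lemma span_ord z : lspan [set` zs] z -> ord 1 z.
Proof.
apply: lspan_min => [|y /= yz]; first exact: subspace_ord.
by have := ord_mul yz (ord_id 0).
Qed.

Lemma mem_ord z : z \in zs -> ord 1 z.
Proof. by move=> zz; apply: span_ord; apply: mem_lspan. Qed.

Lemma span_linear z : lspan [set` zs] z -> linear z.
Proof. by move/span_ord/ord_linear. Qed.

Lemma ord_comp n m u w : ord n u -> ord m w -> ord (n + m) (u \o w).
Proof.
move=> nu mw; elim: nu => {n u} [n|n k u v _ IHu _ IHv|n|n z u zz _ IHu].
- exact: ord_0.
- exact: ord_lin IHu IHv.
- by apply: ord_mono mw; rewrite leq_addl.
- exact: ord_mul IHu.
Qed.

Lemma ord_ltord_comp n m u w : ord n u -> ltord m w -> ltord (n + m) (u \o w).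
Proof.
case: m => [nu ->|m nu mw].
  have -> : u \o (0 : M -> M) = 0.
    by apply/funext => v; rewrite /= (lin0 (ord_linear nu)).
  exact: subspace0 (subspace_ltord _).
by rewrite addnS; apply: ord_comp.
Qed.

Lemma ltord_ord_comp n m u w : ltord n u -> ord m w -> ltord (n + m) (u \o w).
Proof.
case: n => [-> _|n nu mw]; first exact: subspace0 (subspace_ltord _).
by rewrite addSn; apply: ord_comp.
Qed.

Lemma ord_ad_gen n z u : z \in zs -> ord n u -> ord n (comm z u).
Proof.
move=> zz; elim=> {n u} [n|n k u v _ IHu _ IHv|n|n y u yz nu IHu].
- by rewrite comm0; [exact: ord_0 | apply: zsL].
- by rewrite comm_linear_r; [exact: ord_lin | apply: zsL].
- by rewrite comm_id; apply: ord_0.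
- rewrite comm_comp_r; last exact: zsL.
  apply: (subspaceD (subspace_ord _)); last exact: ord_mul.
  by apply: (@ord_comp 1) => //; apply: span_ord; apply: zsbr.
Qed.

Lemma ord_ad n x u : lspan [set` zs] x -> ord n u -> ord n (comm x u).
Proof.
move=> xz nu; apply: (@lspan_lin _ _ _ (comm^~ u) [set` zs]) xz.
- exact/comm_linear_l/ord_linear/nu.
- exact: subspace_ord.
- by move=> z zz; apply: ord_ad_gen.
Qed.

Lemma ltord_ad n x u : lspan [set` zs] x -> ltord n u -> ltord n (comm x u).
Proof.
case: n => [xz ->|n]; last exact: ord_ad.
by rewrite comm0 //; apply: span_linear.
Qed.

(** The associated graded ring is commutative, because a commutator of two
    generators is again a word of length 1. *)
Lemma ord_comm n m u w : ord n u -> ord m w -> ltord (n + m) (comm u w).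
Proof.
move=> nu mw; have wL := ord_linear mw.
elim: nu => {n u} [n|n k u v _ IHu _ IHv|n|n z u zz nu IHu].
- by rewrite commC comm0 // oppr0; apply: subspace0 (subspace_ltord _).
- by rewrite comm_linear_l //; apply: (subspaceP _ (subspace_ltord _)).
- by rewrite commC comm_id oppr0; apply: subspace0 (subspace_ltord _).
rewrite comm_comp_l; last exact: zsL.
apply: (subspaceD (subspace_ltord _)).
  by apply: (@ord_ltord_comp 1) => //; apply: span_ord; apply: mem_lspan.
by rewrite addSn addnC; apply: ord_comp => //; apply: ord_ad_gen.
Qed.

(** * Symbols of operators that vanish on a subspace *)

(** For [u] in [ord n], this says that [u] is, up to shorter words, an operator
    [u - u'] of the left ideal that annihilates [V]. By commutativity of the
    associated graded ring the symbols of a left ideal form a two-sided ideal. *)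
Definition symb (V : set M) n : set (M -> M) :=
  [set u | exists2 u', ltord n u' & forall a, V a -> u a = u' a].

Section Symbols.
Variable V : set M.

Lemma subspace_symb n : subspace (symb V n).
Proof.
have sl := subspace_ltord n.
split; first by exists 0 => //; apply: subspace0.
move=> k u w [u' nu' uu'] [w' nw' ww']; exists (k *: u' + w').
  exact: (subspaceP _ sl).
by move=> v Vv; rewrite !fctE uu' // ww'.
Qed.

Lemma ltord_symb n u : ltord n u -> symb V n u.
Proof. by exists u. Qed.

Lemma symb_mull n m u w : ord m w -> symb V n u -> symb V (m + n) (w \o u).
Proof.
move=> mw [u' nu' uu']; exists (w \o u'); first exact: ord_ltord_comp.
by move=> v Vv /=; rewrite uu'.
Qed.

Lemma symb_congr n u w : ltord n (u - w) -> symb V n w -> symb V n u.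
Proof.
move=> uw nw; rewrite -(subrK w u); apply: (subspaceD (subspace_symb n)) => //.
exact: ltord_symb.
Qed.

Lemma symb_mulr n m u w : ord n u -> ord m w -> symb V n u ->
  symb V (n + m) (u \o w).
Proof.
move=> nu mw su; apply: (@symb_congr _ _ (w \o u)); first exact: (ord_comm nu mw).
by rewrite addnC; apply: symb_mull.
Qed.

Lemma symb_ad n x u : lspan [set` zs] x -> (forall a, V a -> V (x a)) ->
  symb V n u -> symb V n (comm x u).
Proof.
move=> xz xV [u' nu' uu']; exists (comm x u'); first exact: ltord_ad.
by move=> v Vv; rewrite /comm !uu' //; apply: xV.
Qed.

End Symbols.

Lemma ord_iter n z : lspan [set` zs] z -> ord n (iter n z).
Proof.
move=> zz; elim: n => [|n IH]; first exact: ord_id.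
by apply: (@ord_comp 1) => //; apply: span_ord.
Qed.

(** The rule [(z ^ n)' = n z ^ (n - 1) z'] for the derivation [ad x] of the
    associated graded ring. *)
Lemma ord_ad_iter n x z : lspan [set` zs] x -> lspan [set` zs] z ->
  ltord n.+1 (comm x (iter n.+1 z) - n.+1%:R *: (iter n z \o comm x z)).
Proof.
move=> xz zz; have zL := span_linear zz.
have o1z := span_ord zz; have o1xz := ord_ad xz o1z.
elim: n => [|n IH].
  have -> : comm x (iter 1 z) - 1 *: (iter 0 z \o comm x z) = 0.
    by rewrite scale1r subrr.
  exact: subspace0 (subspace_ltord _).
have -> : comm x (iter n.+2 z) - n.+2%:R *: (iter n.+1 z \o comm x z) =
  comm (comm x z) (iter n.+1 z) +
  (z \o (comm x (iter n.+1 z) - n.+1%:R *: (iter n z \o comm x z))).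
  rewrite (_ : iter n.+2 z = z \o iter n.+1 z) // comm_comp_r //.
  apply/funext => v; set w := comm x z; set c := comm x (iter n.+1 z).
  rewrite -[LHS]/(w (z (iter n z v)) + z (c v) - n.+2%:R *: z (iter n z (w v))).
  rewrite -[RHS]/(w (z (iter n z v)) - z (iter n z (w v)) +
                  z (c v - n.+1%:R *: iter n z (w v))).
  move: (c v) (w v) => cv wv.
  by rewrite (linB zL) (linZ zL) mulrS scalerDl scale1r opprD addrACA.
apply: (subspaceD (subspace_ltord _)).
  by apply: (@ord_comm 1 n.+1) => //; apply: ord_iter.
exact: (@ord_ltord_comp 1).
Qed.

(** The same rule multiplied by [z], which avoids the predecessor of [n]. *)
Lemma ord_ad_iter_mul n x z : lspan [set` zs] x -> lspan [set` zs] z ->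
  ltord n.+1 ((comm x (iter n z) \o z) - n%:R *: (comm x z \o iter n z)).
Proof.
move=> xz zz; have zL := span_linear zz.
have o1z := span_ord zz; have o1xz := ord_ad xz o1z.
elim: n => [|n IH].
  rewrite scale0r subr0 (_ : comm x _ \o z = 0); last first.
    by rewrite (_ : iter 0 z = id) // comm_id.
  exact: subspace0 (subspace_ltord _).
have -> : (comm x (iter n.+1 z) \o z) - n.+1%:R *: (comm x z \o iter n.+1 z) =
  (z \o ((comm x (iter n z) \o z) - n%:R *: (comm x z \o iter n z))) +
  n%:R *: (comm z (comm x z) \o iter n z).
  rewrite (_ : iter n.+1 z = z \o iter n z) // comm_comp_r //.
  apply/funext => v; set c := comm x (iter n z); set w := comm x z.
  rewrite -[LHS]/(w (iter n z (z v)) + z (c (z v)) -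
                  n.+1%:R *: w (z (iter n z v))).
  rewrite -[RHS]/(z (c (z v) - n%:R *: w (iter n z v)) +
    n%:R *: (z (w (iter n z v)) - w (z (iter n z v)))).
  rewrite -iterSr iterS; move: (c (z v)) (w _) => cv wv.
  rewrite (linB zL) (linZ zL) mulrS scalerDl scale1r opprD scalerBr.
  by rewrite addrACA subrr add0r addrA subrK.
apply: (subspaceD (subspace_ltord _)); first exact: (@ord_ltord_comp 1).
apply: (subspaceZ _ (subspace_ltord _)).
by apply: (@ltord_ord_comp 2); [apply: (@ord_comm 1 1) | apply: ord_iter].
Qed.

Lemma span_comm x y : lspan [set` zs] x -> lspan [set` zs] y ->
  lspan [set` zs] (comm x y).
Proof.
move=> xz; have xL := span_linear xz.
have sz := subspace_lspan [set` zs].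
apply: lspan_lin => //; first exact: comm_linear_r.
move=> w /= ww; move: x xz {xL}.
apply: (@lspan_lin _ _ _ (comm^~ w)) => // [|z /= zz]; last exact: zsbr.
exact/comm_linear_l/zsL.
Qed.

Hypothesis charK : [pchar K] =i pred0.

(** With [z'] for the bracket of [x] and [z], differentiate [z ^ (a + 1) z' ^ b]
    and multiply by [z']: this gives [(a + 1) z ^ a z' ^ (b + 2)] plus [b z'']
    times the original element. Characteristic zero allows division by [a + 1]. *)
Lemma symb_ad_step V x z a b :
  lspan [set` zs] x -> lspan [set` zs] z -> (forall c, V c -> V (x c)) ->
  symb V (a.+1 + b) (iter a.+1 z \o iter b (comm x z)) ->
  symb V (a + b.+2) (iter a z \o iter b.+2 (comm x z)).
Proof.
move=> xz zz xV; set w := comm x z => sT.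
have wz : lspan [set` zs] w by apply: span_comm.
have w'z : lspan [set` zs] (comm x w) by apply: span_comm.
have PL := ord_linear (ord_iter a.+1 zz).
have sS := subspace_symb V (a + b.+2).
have degE : (a + b.+2 = a.+1 + b.+1)%N by rewrite addSnnS.
have t1 : symb V (a + b.+2) (comm x (iter a.+1 z \o iter b w) \o w).
  rewrite addnS -addSnnS -addn1; apply: symb_mulr.
  - by apply: ord_ad => //; apply: ord_comp; apply: ord_iter.
  - exact: span_ord.
  - exact: symb_ad.
have t2 : symb V (a + b.+2)
    ((comm x (iter a.+1 z) - a.+1%:R *: (iter a z \o w)) \o iter b.+1 w).
  rewrite degE; apply: ltord_symb; apply: ltord_ord_comp; last exact: ord_iter.
  exact: ord_ad_iter.
have t3 : symb V (a + b.+2)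
    (iter a.+1 z \o ((comm x (iter b w) \o w) - b%:R *: (comm x w \o iter b w))).
  rewrite degE; apply: ltord_symb; apply: ord_ltord_comp; first exact: ord_iter.
  exact: ord_ad_iter_mul.
have t4 : symb V (a + b.+2) (iter a.+1 z \o (comm x w \o iter b w)).
  apply: (@symb_congr _ _ _ (comm x w \o (iter a.+1 z \o iter b w))).
    rewrite (_ : _ - _ = comm (iter a.+1 z) (comm x w) \o iter b w) //.
    rewrite degE addnS -addSn; apply: ltord_ord_comp; last exact: ord_iter.
    rewrite -[X in ltord X]addn1; apply: ord_comm; first exact: ord_iter.
    exact: span_ord.
  by rewrite degE addnS -addSn -add1n -addnA; apply: symb_mull => //; apply: span_ord.
have a0 : a.+1%:R != 0 :> K by move/pcharf0P: charK => ->.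
rewrite -[_ \o _](scalerK a0); apply: (subspaceZ _ sS).
(* Leibniz expansion of the derivative of [z ^ (a + 1) z' ^ b], times [z'] *)
rewrite (_ : _ *: _ = (comm x (iter a.+1 z \o iter b w) \o w)
  - ((comm x (iter a.+1 z) - a.+1%:R *: (iter a z \o w)) \o iter b.+1 w)
  - (iter a.+1 z \o ((comm x (iter b w) \o w) - b%:R *: (comm x w \o iter b w)))
  - b%:R *: (iter a.+1 z \o (comm x w \o iter b w))).
  apply: (subspaceB sS); last exact: (subspaceZ _ sS).
  by apply: (subspaceB sS) => //; apply: (subspaceB sS).
rewrite comm_comp_r //; apply/funext => v.
have e : iter b.+1 w v = iter b w (w v) by rewrite iterSr.
pose c1 := comm x (iter a.+1 z) (iter b w (w v)).
pose c2 := comm x (iter b w) (w v).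
rewrite -[LHS]/(a.+1%:R *: iter a z (w (iter b.+1 w v))).
rewrite -[RHS]/(c1 + iter a.+1 z c2 - (comm x (iter a.+1 z) (iter b.+1 w v)
  - a.+1%:R *: iter a z (w (iter b.+1 w v)))
  - iter a.+1 z (c2 - b%:R *: comm x w (iter b w v))
  - b%:R *: iter a.+1 z (comm x w (iter b w v))).
rewrite [in comm _ _ _]e -/c1; move: c1 c2 => c1 c2.
move: (comm x w _) => d.
rewrite (linB PL) (linZ PL) !opprB !addrA.
by rewrite [RHS](ACl (3*(1*4)*(2*6)*(5*7))%AC) /= !subrr !addr0.
Qed.

(** In a commutative ring of characteristic zero, the radical of an ideal that is
    stable under a derivation is stable too; this is the same argument in the
    associated graded ring. Differentiating [z ^ n] step by step trades each
    factor [z] for two factors [z']. *)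
Lemma symb_iter_comm V x z n :
  lspan [set` zs] x -> lspan [set` zs] z -> (forall c, V c -> V (x c)) ->
  symb V n (iter n z) -> symb V (n + n) (iter (n + n) (comm x z)).
Proof.
move=> xz zz xV sn.
have sk k a : (a + k = n)%N ->
    symb V (a + k.*2) (iter a z \o iter k.*2 (comm x z)).
  elim: k a => [a|k IH a ak]; first by rewrite !addn0 => ->.
  by rewrite doubleS; apply: symb_ad_step => //; apply: IH; rewrite addSnnS.
by have := sk n 0%N erefl; rewrite add0n addnn.
Qed.

(** Integrality over lower-order operators, uniformly on every
    finite-dimensional subspace. Bracketing with a locally finite [x] preserves
    it since [V] can be enlarged to an [x]-stable subspace. *)
Definition integral z :=
  forall V : set M, finite_dim V -> exists n, symb V n (iter n z).

Lemma symb_sub (U V : set M) n u : U `<=` V -> symb V n u -> symb U n u.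
Proof. by move=> UV [u' nu' uu']; exists u' => // a /UV/uu'. Qed.

(** * Long words in integral operators *)

Definition word (ws : seq (M -> M)) : M -> M := foldr (fun z u => z \o u) id ws.

Lemma ord_word ws : {subset ws <= zs} -> ord (size ws) (word ws).
Proof.
elim: ws => [_|z ws IH wz] /=; first exact: ord_id.
apply: ord_mul; first by apply: wz; rewrite mem_head.
by apply: IH => y yw; apply: wz; rewrite inE yw orbT.
Qed.

(** Moving the letters [z] to the front only creates commutators, which are
    shorter. *)
Lemma word_collect z ws : z \in zs -> {subset ws <= zs} ->
  ltord (size ws) (word ws -
    (iter (count_mem z ws) z \o word [seq y <- ws | y != z])).
Proof.
move=> zz; elim: ws => [_|y ws IH wz] /=; first by rewrite subrr.
have yz : y \in zs by apply: wz; rewrite mem_head.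
have {}wz : {subset ws <= zs} by move=> w ww; apply: wz; rewrite inE ww orbT.
have o1 : ltord (size ws).+1 (y \o (word ws -
    (iter (count_mem z ws) z \o word [seq y <- ws | y != z]))).
  apply: (@ord_ltord_comp 1); last exact: IH.
  exact: mem_ord.
have [yE|yz'] /= := eqVneq y z.
  rewrite -yE in o1 *; rewrite (_ : _ - _ = y \o (word ws -
    (iter (count_mem y ws) y \o word [seq w <- ws | w != y]))) //.
  apply/funext => v; rewrite -[RHS]/(y (word ws v -
    iter (count_mem y ws) y (word [seq w <- ws | w != y] v))).
  by rewrite (linB (zsL yz)).
set c := iter _ z; set r := word [seq y <- ws | y != z].
rewrite (_ : _ - _ = (y \o (word ws - (c \o r))) + (comm y c \o r)).
  apply: (subspaceD (subspace_ord _)); first exact: o1.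
  have rE : (size ws = count_mem z ws + size [seq y <- ws | y != z])%N.
    by rewrite size_filter -(count_predC (pred1 z) ws).
  rewrite rE; apply: ord_comp.
    apply: (@ord_comm 1 (count_mem z ws)); first exact: mem_ord.
    by apply: ord_iter; apply: mem_lspan.
  by apply: ord_word => w; rewrite mem_filter => /andP[_ /wz].
apply/funext => v; rewrite -[LHS]/(y (word ws v) - c (y (r v))).
rewrite -[RHS]/(y (word ws v - c (r v)) + (y (c (r v)) - c (y (r v)))).
by rewrite (linB (zsL yz)) addrA subrK.
Qed.

Lemma pigeonhole_count (T : eqType) (N : nat) (ys ws : seq T) :
  {subset ws <= ys} -> (size ys * N < size ws)%N ->
  exists2 y, y \in ys & (N <= count_mem y ws)%N.
Proof.
elim: ys ws => [|y ys IH] ws wy.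
  by case: ws wy => // w ws /(_ w (mem_head _ _)).
move=> sz; have [Nc|cN] := leqP N (count_mem y ws).
  by exists y => //; rewrite mem_head.
have [||x xy xc] := IH [seq w <- ws | w != y].
- by move=> w; rewrite mem_filter => /andP[wny /wy]; rewrite inE (negPf wny).
- move: sz; rewrite -(count_predC (pred1 y) ws) size_filter mulSn /=.
  by move=> sz; rewrite -(ltn_add2l N) (leq_trans sz) // leq_add2r ltnW.
exists x; first by rewrite inE xy orbT.
by rewrite (leq_trans xc) // count_filter; apply: sub_count => w /andP[].
Qed.

Lemma symb_iter_mono V n m z : z \in zs -> (n <= m)%N ->
  symb V n (iter n z) -> symb V m (iter m z).
Proof.
move=> zz /subnK <-; move: (m - n)%N => k nz; elim: k => [//|k IH].
by apply: (@symb_mull _ _ 1) => //; apply: mem_ord.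
Qed.

Section Stabilization.
Variables (V : set M) (N : nat).
Hypothesis NP : forall z, z \in zs -> symb V N (iter N z).

Lemma symb_long_word ws : {subset ws <= zs} -> (size zs * N < size ws)%N ->
  symb V (size ws) (word ws).
Proof.
move=> wz sz; have [z zz zc] := pigeonhole_count wz sz.
apply: symb_congr (word_collect zz wz) _.
rewrite (_ : size ws = count_mem z ws + size [seq y <- ws | y != z])%N; last first.
  by rewrite size_filter -(count_predC (pred1 z) ws).
apply: symb_mulr.
- by apply: ord_iter; apply: mem_lspan.
- by apply: ord_word => w; rewrite mem_filter => /andP[_ /wz].
- exact: symb_iter_mono (NP zz).
Qed.

(** The induction peels letters off the left of [u] and moves them to the front
    of the explicit word [ws], until the pigeonhole principle applies. *)
Lemma symb_high_order m u : ord m u -> forall ws, {subset ws <= zs} ->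
  (size zs * N < m + size ws)%N -> symb V (m + size ws) (u \o word ws).
Proof.
elim=> {m u} [m|m k u v _ IHu _ IHv|m|m z u zz mu IH] ws wz sz.
- exact: subspace0 (subspace_symb _ _).
- by apply: (subspaceP _ (subspace_symb V _)); [exact: IHu | exact: IHv].
- case: m sz => [|m] sz; first exact: symb_long_word.
  apply: ltord_symb; apply: (@ltord_mono (size ws).+1); last exact: ord_word.
  by rewrite addSn ltnS leq_addl.
apply: (@symb_congr _ _ _ (u \o word (z :: ws))).
  rewrite (_ : _ - _ = comm z u \o word ws) //.
  by rewrite addSn; apply: ord_comp; [apply: ord_ad_gen | apply: ord_word].
rewrite addSnnS; apply: (IH (z :: ws)); last by rewrite /= -addSnnS.
by move=> y; rewrite inE => /orP[/eqP ->|/wz].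
Qed.

Lemma ord_stab z u : z \in zs -> ord (size zs * N) u ->
  exists2 u', ord (size zs * N) u' & forall a, V a -> z (u a) = u' a.
Proof.
move=> zz Bu; have [||u' Bu' uu'] := symb_high_order (ord_mul zz Bu) (ws := [::]).
- by [].
- by rewrite addn0.
by rewrite addn0 in Bu'; exists u'.
Qed.

End Stabilization.

Lemma ord_orbit a n :
  exists t : seq M, forall u, ord n u -> lspan [set` t] (u a).
Proof.
pose orb := fix orb n : seq M :=
  if n is n'.+1 then a :: [seq z b | z <- zs, b <- orb n'] else [:: a].
exists (orb n) => u nu; elim: nu => {n u} [n|n k u v _ IHu _ IHv|n|n z u zz _ IH].
- exact: subspace0 (subspace_lspan _).
- exact: (subspaceP _ (subspace_lspan _)).
- by apply: mem_lspan; case: n => [|n]; rewrite /= mem_head.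
apply: lspan_lin IH; [exact: zsL | exact: subspace_lspan | move=> b /= bo].
by apply: mem_lspan; rewrite inE allpairs_f ?orbT.
Qed.

(** Every word of length more than [size zs * N] agrees on [V] with a shorter one,
    so words of that length already produce a stable subspace. *)
Lemma locally_finite_gens : (forall z, z \in zs -> integral z) ->
  forall a, exists U : set M, [/\ subspace U, finite_dim U, U a &
    forall z b, z \in zs -> U b -> U (z b)].
Proof.
move=> zI a; have fV : finite_dim (lspan [set` [:: a]]) by exists [:: a].
have [N NP] : exists N, forall z, z \in zs ->
    symb (lspan [set` [:: a]]) N (iter N z).
  have: forall z, z \in zs -> z \in zs /\ integral z by move=> z zz; split; [|apply: zI].
  elim: {1 3}zs => [|z s IH] sz; first by exists 0%N.
  have [|N NP] := IH; first by move=> y ys; apply: sz; rewrite inE ys orbT.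
  have [zz /(_ _ fV) [n nz]] := sz z (mem_head _ _).
  exists (maxn n N) => y; rewrite inE => /orP[/eqP ->|ys].
    exact: (symb_iter_mono zz (leq_maxl _ _)).
  have [yz _] : y \in zs /\ integral y by apply: sz; rewrite inE ys orbT.
  exact: (symb_iter_mono yz (leq_maxr _ _) (NP _ ys)).
set B := (size zs * N)%N.
have sU : subspace ((fun u : M -> M => u a) @` ord B).
  exact: subspace_image (subspace_ord B).
exists ((fun u : M -> M => u a) @` ord B); split=> //.
- have [t tP] := ord_orbit a B.
  by apply: (finite_dim_sub (t := t)) => // _ [u Bu <-]; apply: tP.
- by exists id => //; apply: ord_id.
move=> z _ zz [u Bu <-]; have [u' Bu' uu'] := ord_stab NP zz Bu.
by exists u' => //; rewrite uu' //; apply: mem_lspan; rewrite mem_head.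
Qed.

End Filtration.

(** * Locally finite families of operators *)

(** For operators on an algebra this is [locally_finite]. *)
Definition locfin (K : fieldType) (M : lmodType K) (L : set (M -> M)) : Prop :=
  forall a : M, exists U : set M,
    [/\ subspace U, finite_dim U, U a & forall D, L D -> D @` U `<=` U].

Section LocallyFinite.
Variables (K : fieldType) (M : lmodType K).
Implicit Types (L X : set (M -> M)).

Lemma locfin_seq L (s : seq M) : (forall D, L D -> linear D) -> locfin L ->
  exists U : set M, [/\ subspace U, finite_dim U, forall a, a \in s -> U a &
    forall D a, L D -> U a -> U (D a)].
Proof.
move=> LL Llf; elim: s => [|a s [U [sU [t tU] Us UD]]].
  exists (lspan [set` [::]]); split=> //; first exact: subspace_lspan.
    by exists [::].
  by move=> D a LD /lspan_nil ->; rewrite (lin0 (LL D LD)); apply: subspace0 (subspace_lspan _).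
have [W [sW [r rW] Wa WD]] := Llf a.
have sUW := subspace_sum sU sW.
exists [set v | exists u w, [/\ U u, W w & v = u + w]]; split=> //.
- apply: (finite_dim_sub (t := t ++ r)) => // _ [u [w [Uu Ww ->]]].
  apply: (subspaceD (subspace_lspan _)).
    move: Uu; rewrite tU; apply: lspan_mono => x /= xt.
    by rewrite mem_cat xt.
  move: Ww; rewrite rW; apply: lspan_mono => x /= xr.
  by rewrite mem_cat xr orbT.
- move=> b; rewrite inE => /orP[/eqP ->|bs].
    by exists 0, a; rewrite add0r; split=> //; apply: subspace0.
  by exists b, 0; rewrite addr0; split; [exact: Us | exact: subspace0|].
move=> D _ LD [u [w [Uu Ww ->]]]; exists (D u), (D w).
rewrite (linD (LL D LD)); split=> //; first exact: UD.
by apply: (WD D LD); exists w.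
Qed.

Lemma locfin_sub L X : X `<=` L -> locfin L -> locfin X.
Proof.
move=> XL Llf a; have [U [sU fU Ua UD]] := Llf a.
by exists U; split=> // D /XL; apply: UD.
Qed.

Lemma locfin_lspan L : locfin L -> locfin (lspan L).
Proof.
move=> Llf a; have [U [sU fU Ua UD]] := Llf a; exists U; split=> //.
move=> D LD _ [u Uu <-].
apply: (@lspan_lin _ _ _ (fun D : M -> M => D u) L U) LD => // E LE.
by apply: (UD E LE); exists u.
Qed.

End LocallyFinite.

Section Integrality.
Variables (K : fieldType) (M : lmodType K) (zs : seq (M -> M)).
Hypothesis zsL : forall z, z \in zs -> linear z.
Hypothesis zsbr : forall z w, z \in zs -> w \in zs -> lspan [set` zs] (comm z w).

(** Let [U] be finite-dimensional, stable under [x] and contain [V]. The operators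
    of the filtration that preserve [U] restrict to a finite-dimensional space of
    maps from [V] to [U]. Finitely many of them span all the restrictions, and
    these have bounded order; so a power of [x] beyond that order agrees on [V]
    with an operator of lower order. *)
Lemma integral_locfin x : lspan [set` zs] x -> locfin [set x] ->
  integral zs x.
Proof.
move=> xz xlf V [s Vs]; have xL := span_linear zsL xz.
have [|U [sU [t Ut] Us Ux]] := locfin_seq s _ xlf; first by move=> D ->.
pose W : set (M -> M) :=
  [set u | (exists n, ord zs n u) /\ forall a, U a -> U (u a)].
have sW : subspace W.
  split=> [|k u v [[n nu] uU] [[m mv] vU]].
    by split; [exists 0%N; apply: ord_0 | move=> a _; apply: subspace0].
  split; last by move=> a Ua; apply: (subspaceP _ sU); [exact: uU | exact: vU].
  exists (maxn n m); apply: ord_lin.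
    by apply: ord_mono nu; rewrite leq_maxl.
  by apply: ord_mono mv; rewrite leq_maxr.
have [|us [usW usP]] := @finite_mod_values _ _ _ W s t sW.
  by move=> w p [_ wU] /Us/wU; rewrite Ut.
have [n usn] : exists n, forall u, u \in us -> ord zs n u.
  elim: us usW {usP} => [|u us IH] usW; first by exists 0%N.
  have [|n nP] := IH; first by move=> v vus; apply: usW; rewrite inE vus orbT.
  have [[m mu] _] := usW u (mem_head _ _).
  exists (maxn n m) => v; rewrite inE => /orP[/eqP ->|/nP].
    by apply: ord_mono mu; rewrite leq_maxr.
  by apply: ord_mono; rewrite leq_maxl.
have nx := ord_iter n.+1 xz.
have [|u usu xu] := usP (iter n.+1 x).
  split; first by exists n.+1.
  by elim: (n.+1) => [//|k IH] a Ua; apply: (Ux x) => //; exact: IH.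
have nu : ord zs n u by apply: lspan_min usu => //; apply: subspace_ord.
exists n.+1, u => // a; rewrite Vs => sa; apply/eqP; rewrite -subr_eq0; apply/eqP.
have dL : linear (fun a => iter n.+1 x a - u a).
  move=> k b c; rewrite (ord_linear zsL nx) (ord_linear zsL nu).
  by rewrite scalerBr opprD addrACA.
apply: (@lspan_lin _ _ _ _ [set` s] [set 0] dL) sa.
  by split=> // k b c -> ->; rewrite scaler0 addr0.
by move=> p ps; apply/eqP; rewrite subr_eq0; apply/eqP; exact: xu.
Qed.

Lemma integral_comm x z : [pchar K] =i pred0 -> lspan [set` zs] x ->
  lspan [set` zs] z -> locfin [set x] -> integral zs z ->
  integral zs (comm x z).
Proof.
move=> charK xz zz xlf zI V [s Vs]; have xL := span_linear zsL xz.
have [|U [sU fU Us Ux]] := locfin_seq s _ xlf; first by move=> D ->.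
have [n nz] := zI U fU; exists (n + n)%N.
apply: (@symb_sub _ _ _ V U); first by rewrite Vs; apply: lspan_min.
by apply: (symb_iter_comm zsL zsbr charK xz zz) nz => a; exact: Ux.
Qed.

End Integrality.

(** * Lie algebras generated by locally finite operators *)

Inductive brackets (M : zmodType) (X : set (M -> M)) : set (M -> M) :=
| brackets_gen x : X x -> brackets X x
| brackets_comm x z : X x -> brackets X z -> brackets X (comm x z).

Section Brackets.
Variables (K : fieldType) (M : lmodType K) (X : set (M -> M)).
Hypothesis XL : forall x, X x -> linear x.

Lemma brackets_linear z : brackets X z -> linear z.
Proof.
elim=> {z} [x /XL //|x z /XL xL _ zL]; exact: linear_comm.
Qed.

Lemma span_brackets_linear z : lspan (brackets X) z -> linear z.
Proof.
have sL : subspace [set z : M -> M | linear z].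
  by split=> [|k u v]; [exact: linear_0 | exact: linear_comb].
by apply: (lspan_min sL) => w; apply: brackets_linear.
Qed.

(** Right-normed brackets suffice because, by the Jacobi identity, bracketing
    with an iterated bracket reduces to bracketing with the generators. *)
Lemma brackets_closed z w :
  lspan (brackets X) z -> lspan (brackets X) w -> lspan (brackets X) (comm z w).
Proof.
move=> zX wX; have wL := span_brackets_linear wX; have sX := subspace_lspan (brackets X).
apply: (@lspan_lin _ _ _ (comm^~ w) _ _ _ sX) zX; first exact: comm_linear_l.
move=> {}z zX; elim: zX w wX {wL} => {z} [x Xx|x z Xx zX IH] w wX.
  apply: (@lspan_lin _ _ _ (comm x) _ _ _ sX) wX.
    exact/comm_linear_r/XL.
  by move=> y yX; apply: sub_lspan; apply: brackets_comm.
have xX (y : M -> M) : lspan (brackets X) y -> lspan (brackets X) (comm x y).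
  apply: lspan_lin => //; first exact/comm_linear_r/XL.
  by move=> u uX; apply: sub_lspan; apply: brackets_comm.
rewrite comm_jacobi; [|exact: XL|exact: brackets_linear|exact: span_brackets_linear].
by apply: (subspaceB sX); [apply: xX; apply: IH | apply: IH; apply: xX].
Qed.

(** The list [ts] only says that the Lie algebra is finite-dimensional; the proof
    replaces it by a spanning list of iterated brackets, all of them integral. *)
Theorem locfin_brackets (ts : seq (M -> M)) : [pchar K] =i pred0 ->
  (forall x, X x -> locfin [set x]) -> brackets X `<=` lspan [set` ts] ->
  locfin (lspan (brackets X)).
Proof.
move=> charK Xlf Xts.
have [|zs zsX zsE] := @finite_dim_gen _ _ (brackets X) ts.
  by apply: lspan_min => //; apply: subspace_lspan.
have zsL z : z \in zs -> linear z by move/zsX/brackets_linear.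
have zsbr z w : z \in zs -> w \in zs -> lspan [set` zs] (comm z w).
  by move=> /zsX zX /zsX wX; rewrite -zsE; apply: brackets_closed; apply: sub_lspan.
have Xzs x : X x -> lspan [set` zs] x.
  by move=> Xx; rewrite -zsE; apply: sub_lspan; apply: brackets_gen.
have XI z : brackets X z -> integral zs z.
  elim=> {z} [x Xx|x z Xx zX zI].
    exact: integral_locfin (Xzs x Xx) (Xlf x Xx).
  apply: integral_comm => //; [exact: Xzs | | exact: Xlf].
  by rewrite -zsE; apply: sub_lspan.
rewrite zsE; apply: locfin_lspan => a.
have [U [sU fU Ua UD]] := locally_finite_gens zsL zsbr (fun z h => XI z (zsX z h)) a.
by exists U; split=> // z zz _ [b Ub <-]; apply: UD.
Qed.

End Brackets.

(** * Subquotients of vector spaces *)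

Section Subquotient.
Variables (K : fieldType) (V : lmodType K) (P N : set V).
Hypotheses (sP : subspace P) (sN : subspace N).

Definition subquot_rep (v : V) : V := xget 0 [set w | P w /\ N (w - v)].

Lemma subquot_repP v : P v -> P (subquot_rep v) /\ N (subquot_rep v - v).
Proof.
move=> Pv; rewrite /subquot_rep; case: xgetP => [x _ //|/(_ v) []].
by split=> //; rewrite subrr; apply: subspace0.
Qed.

Lemma subquot_rep_eq u v : N (u - v) -> subquot_rep u = subquot_rep v.
Proof.
move=> Nuv; congr (xget 0 _); apply/seteqP; split=> w [Pw Nw]; split=> //.
  by rewrite -(subrK u w) -addrA; apply: (subspaceD sN).
rewrite -(subrK v w) -addrA; apply: (subspaceD sN) => //.
by rewrite -opprB -sub0r; apply: (subspaceB sN) => //; apply: subspace0.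
Qed.

Let canonical_rep (v : V) := `[< P v /\ subquot_rep v = v >].

Lemma subquot_rep_canonical v : P v -> canonical_rep (subquot_rep v).
Proof.
move=> Pv; apply/asboolP; have [Pr Nr] := subquot_repP Pv.
by split=> //; apply: subquot_rep_eq.
Qed.

(** The quotient [P / N], encoded by one chosen representative in each class. The
    two proofs are arguments of the type so that its vector space structure,
    which depends on them, can be inferred. *)
Definition subquot of subspace P & subspace N : Type := {v : V | canonical_rep v}.
Local Notation Q := (subquot sP sN).

HB.instance Definition _ := Choice.copy Q {v : V | canonical_rep v}.

Definition subquot_val (q : Q) : V := sval q.

Definition subquot_pi (v : V) : Q :=
  match pselect (P v) with
  | left Pv => exist canonical_rep _ (subquot_rep_canonical Pv)
  | right _ => exist canonical_rep _ (subquot_rep_canonical (subspace0 sP))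
  end.

Lemma subquot_valP q : P (subquot_val q).
Proof. by case: q => v vP; case/asboolP: (vP). Qed.

Lemma subquot_valK : cancel subquot_val subquot_pi.
Proof.
move=> [v vP]; rewrite /subquot_pi /subquot_val /=; apply: val_inj => /=.
by case/asboolP: (vP) => Pv rv; case: pselect.
Qed.

Lemma subquot_pi_eq u v : P u -> P v -> subquot_pi u = subquot_pi v <-> N (u - v).
Proof.
move=> Pu Pv; rewrite /subquot_pi; case: pselect => // Pu'; case: pselect => // Pv'.
split=> [[ruv]|/subquot_rep_eq ruv]; last exact: val_inj.
have [_ Nu] := subquot_repP Pu; have [_ Nv] := subquot_repP Pv.
rewrite -(subrK (subquot_rep u) u) -addrA; apply: (subspaceD sN).
  by rewrite -opprB -sub0r; apply: (subspaceB sN) => //; apply: subspace0.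
by rewrite ruv.
Qed.

Lemma subquot_piK v : P v -> N (subquot_val (subquot_pi v) - v).
Proof.
move=> Pv; apply/subquot_pi_eq => //; first exact: subquot_valP.
by rewrite subquot_valK.
Qed.

Let add (p q : Q) := subquot_pi (subquot_val p + subquot_val q).
Let opp (p : Q) := subquot_pi (- subquot_val p).
Let scale (k : K) (p : Q) := subquot_pi (k *: subquot_val p).

Let P_N u : P u -> P (- u).
Proof. by move=> Pu; rewrite -sub0r; apply: (subspaceB sP) => //; apply: subspace0. Qed.

Let addE u v : P u -> P v -> add (subquot_pi u) (subquot_pi v) = subquot_pi (u + v).
Proof.
move=> Pu Pv; apply/subquot_pi_eq; try by apply: (subspaceD sP) => //; exact: subquot_valP.
by rewrite opprD addrACA; apply: (subspaceD sN); apply: subquot_piK.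
Qed.

Let scaleE k u : P u -> scale k (subquot_pi u) = subquot_pi (k *: u).
Proof.
move=> Pu; apply/subquot_pi_eq; try by apply: (subspaceZ _ sP) => //; exact: subquot_valP.
by rewrite -scalerBr; apply: (subspaceZ _ sN); apply: subquot_piK.
Qed.

Let oppE u : P u -> opp (subquot_pi u) = subquot_pi (- u).
Proof.
move=> Pu; rewrite -[- u]scaleN1r -scaleE // /opp /scale scaleN1r //.
Qed.

Let surj q : exists2 v, P v & q = subquot_pi v.
Proof.
by exists (subquot_val q); [exact: subquot_valP | rewrite subquot_valK].
Qed.

Let addA : associative add.
Proof.
move=> p q r; have [u Pu ->] := surj p; have [v Pv ->] := surj q.
have [w Pw ->] := surj r.
by rewrite !addE // ?addrA //; apply: (subspaceD sP).
Qed.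

Let addC : commutative add.
Proof. by move=> p q; rewrite /add addrC. Qed.

Let add0 : left_id (subquot_pi 0) add.
Proof.
move=> p; have [u Pu ->] := surj p; rewrite addE ?add0r //; exact: subspace0.
Qed.

Let addN : left_inverse (subquot_pi 0) opp add.
Proof.
by move=> p; have [u Pu ->] := surj p; rewrite oppE // addE ?addNr //; apply: P_N.
Qed.

HB.instance Definition _ := GRing.isZmodule.Build Q addA addC add0 addN.

Let scaleA k l q : scale k (scale l q) = scale (k * l) q.
Proof.
have [u Pu ->] := surj q; rewrite !scaleE ?scalerA //; exact: (subspaceZ _ sP).
Qed.

Let scale1 : left_id 1 scale.
Proof. by move=> q; have [u Pu ->] := surj q; rewrite scaleE // scale1r. Qed.

Let scaleDr : right_distributive scale +%R.
Proof.
move=> k p q; have [u Pu ->] := surj p; have [v Pv ->] := surj q.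
rewrite -[_ + _]/(add _ _) -[RHS]/(add _ _) addE // !scaleE //; last exact: (subspaceD sP).
by rewrite addE ?scalerDr //; apply: (subspaceZ _ sP).
Qed.

Let scaleDl q : {morph scale^~ q : k l / k + l}.
Proof.
move=> k l; have [u Pu ->] := surj q; rewrite -[RHS]/(add _ _) !scaleE //.
by rewrite addE ?scalerDl //; apply: (subspaceZ _ sP).
Qed.

HB.instance Definition _ :=
  GRing.Zmodule_isLmodule.Build K Q scaleA scale1 scaleDr scaleDl.

Lemma subquot_piP k u v : P u -> P v ->
  subquot_pi (k *: u + v) = k *: subquot_pi u + subquot_pi v.
Proof.
move=> Pu Pv; rewrite -[RHS]/(add (scale k _) _) scaleE // addE //.
exact: (subspaceZ _ sP).
Qed.

Lemma subquot_pi0 v : P v -> subquot_pi v = 0 <-> N v.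
Proof.
move=> Pv; rewrite -[X in N X]subr0 -[0 : Q]/(subquot_pi 0).
by apply: subquot_pi_eq => //; apply: subspace0.
Qed.

End Subquotient.

(** * Descending the derived series *)

(** For maps that are linear on the subspace [P] only, such as the projection
    onto a subquotient and the adjoint action below. *)
Lemma lspan_lin_on (K : fieldType) (V W : lmodType K) (f : V -> W)
    (P X : set V) (U : set W) :
  subspace P -> subspace U ->
  (forall k u v, P u -> P v -> f (k *: u + v) = k *: f u + f v) ->
  (forall v, X v -> P v /\ U (f v)) -> forall v, lspan X v -> P v /\ U (f v).
Proof.
move=> sP sU fL XU; apply: lspan_min => //; split.
  split; first exact: subspace0.
  have P0 := subspace0 sP.
  have -> : f 0 = 0.
    by have := fL (-1) 0 0 P0 P0; rewrite scaler0 addr0 scaleN1r addNr.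
  exact: subspace0.
move=> k u v [Pu Uu] [Pv Uv]; split; first exact: (subspaceP _ sP).
by rewrite fL //; apply: (subspaceP _ sU).
Qed.

Section DerivedStep.
Variables (K : fieldType) (M : lmodType K) (h I : set (M -> M)) (xs : seq (M -> M)).
Hypothesis charK : [pchar K] =i pred0.
Hypothesis hL : forall D, h D -> linear D.
Hypothesis sh : subspace h.
Hypothesis h_comm : forall D E, h D -> h E -> h (comm D E).
Hypothesis h_gen : h = lspan (brackets [set` xs]).
Hypothesis ad_locfin : forall x D, x \in xs -> h D -> exists T : set (M -> M),
  [/\ subspace T, finite_dim T, T D & forall E, T E -> T (comm x E)].
Hypothesis sI : subspace I.
Hypothesis Ih : I `<=` h.
Hypothesis I_ideal : forall D E, h D -> I E -> I (comm D E).

Let I' : set (M -> M) := lspan [set comm D E | D in I & E in I].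

Let sI' : subspace I'. Proof. exact: subspace_lspan. Qed.

Lemma derived_sub : I' `<=` I.
Proof.
by apply: lspan_min => // _ [D ID [E IE <-]]; apply: I_ideal => //; apply: Ih.
Qed.

Lemma derived_ideal D E : h D -> I' E -> I' (comm D E).
Proof.
move=> hD; apply: lspan_lin => //; first exact/comm_linear_r/hL.
move=> _ [F IF [G IG <-]].
have DL := hL hD; have FL := hL (Ih IF); have GL := hL (Ih IG).
have -> : comm D (comm F G) = comm (comm D F) G + comm F (comm D G).
  by rewrite comm_jacobi // subrK.
apply: (subspaceD sI'); apply: sub_lspan.
  by exists (comm D F); [apply: I_ideal | exists G].
by exists F => //; exists (comm D G); [apply: I_ideal | ].
Qed.

Local Notation Q := (subquot sI sI').
Local Notation pi := (subquot_pi sI sI').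
Let piP k u v : I u -> I v -> pi (k *: u + v) = k *: pi u + pi v.
Proof. exact: subquot_piP. Qed.

Let pi_eq u v : I u -> I v -> I' (u - v) -> pi u = pi v.
Proof. by move=> Iu Iv uv; apply/subquot_pi_eq. Qed.

Let surj (q : Q) : exists2 v, I v & q = pi v.
Proof.
by exists (subquot_val q); [exact: subquot_valP | rewrite subquot_valK].
Qed.

(** The adjoint action of [h] on [I / I']. As [I] acts trivially
    (lemma [ad_subquot0]), it factors through [h / I]. *)
Definition ad_subquot (D : M -> M) : Q -> Q :=
  fun q => pi (comm D (subquot_val q)).

Lemma ad_subquot_pi D v : h D -> I v -> ad_subquot D (pi v) = pi (comm D v).
Proof.
move=> hD Iv; apply: pi_eq; try by apply: I_ideal => //; exact: subquot_valP.
rewrite -(linB (comm_linear_r (hL hD))); apply: derived_ideal => //.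
exact: (subquot_piK sI sI' Iv).
Qed.

Lemma ad_subquot_linear D : h D -> linear (ad_subquot D).
Proof.
move=> hD k p q; have [u Iu ->] := surj p; have [v Iv ->] := surj q.
rewrite -piP // !ad_subquot_pi //; last exact: (subspaceP _ sI).
by rewrite (comm_linear_r (hL hD)) piP //; apply: I_ideal.
Qed.

Lemma ad_subquot_add k D E : h D -> h E ->
  ad_subquot (k *: D + E) = k *: ad_subquot D + ad_subquot E.
Proof.
move=> hD hE; apply/funext => q; have [u Iu ->] := surj q.
rewrite !fctE !ad_subquot_pi //; last exact: (subspaceP _ sh).
by rewrite (comm_linear_l (hL (Ih Iu))) piP //; apply: I_ideal.
Qed.

Lemma ad_subquot_comm D E : h D -> h E ->
  ad_subquot (comm D E) = comm (ad_subquot D) (ad_subquot E).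
Proof.
move=> hD hE; apply/funext => q; have [u Iu ->] := surj q.
have IDu := I_ideal hD Iu; have IEu := I_ideal hE Iu.
rewrite [RHS]/comm !ad_subquot_pi //; last exact: h_comm.
rewrite (comm_jacobi (hL hD) (hL hE) (hL (Ih Iu))) addrC -scaleN1r.
by rewrite piP ?scaleN1r 1?addrC //; apply: I_ideal.
Qed.

Lemma ad_subquot0 D : I D -> ad_subquot D = 0.
Proof.
move=> ID; apply/funext => q; have [u Iu ->] := surj q.
rewrite ad_subquot_pi //; last exact: Ih.
apply/subquot_pi0; first by apply: I_ideal => //; apply: Ih.
by apply: sub_lspan; exists D => //; exists u.
Qed.

Let X : set (Q -> Q) := [set ad_subquot x | x in [set` xs]].

Lemma h_xs x : x \in xs -> h x.
Proof. by move=> xx; rewrite h_gen; apply: sub_lspan; apply: brackets_gen. Qed.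

Lemma brackets_h z : brackets [set` xs] z -> h z.
Proof. by rewrite h_gen => zX; apply: sub_lspan. Qed.

Lemma brackets_ad_subquot z :
  brackets [set` xs] z -> brackets X (ad_subquot z).
Proof.
elim=> {z} [x xx|x z xx zX IH]; first by apply: brackets_gen; exists x.
rewrite ad_subquot_comm; [|exact: h_xs|exact: brackets_h].
by apply: brackets_comm => //; exists x.
Qed.

Lemma brackets_ad_subquot_inv z : brackets X z ->
  exists2 D, h D & z = ad_subquot D.
Proof.
elim=> {z} [_ [x xx <-]|_ z [x xx <-] _ [D hD ->]].
  by exists x => //; apply: h_xs.
have hx := h_xs xx.
by exists (comm x D); [apply: h_comm | rewrite ad_subquot_comm].
Qed.

Lemma ad_subquot_span D : h D -> lspan (brackets X) (ad_subquot D).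
Proof.
move=> hD; have := hD; rewrite {1}h_gen => bD.
apply: (lspan_lin_on sh (subspace_lspan (brackets X)) ad_subquot_add _ bD).2.
by move=> z zX; split; [apply: brackets_h | apply: sub_lspan; apply: brackets_ad_subquot].
Qed.

Lemma ad_subquot_locfin x : x \in xs -> locfin [set ad_subquot x].
Proof.
move=> xx q; have hx := h_xs xx; have [v Iv ->] := surj q.
have [T [sT [t Tt] Tv Tx]] := ad_locfin xx (Ih Iv).
have sTI := subspaceI sT sI.
have [||r TIr] := @finite_dim_sub _ _ (T `&` I) t => //.
  by move=> u [Tu _]; rewrite -Tt.
have sU : subspace (pi @` (T `&` I)).
  split; first by exists 0; [apply: subspace0 | apply/subquot_pi0 => //; apply: subspace0].
  move=> k _ _ [u [Tu Iu] <-] [w [Tw Iw] <-]; exists (k *: u + w).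
    by apply: (subspaceP _ sTI).
  exact: piP.
exists (pi @` (T `&` I)); split=> //.
- apply: (@finite_dim_sub _ _ _ (map pi r)) => // _ [u TIu <-].
  move: TIu; rewrite TIr => ru.
  apply: (lspan_lin_on sI (subspace_lspan [set` map pi r]) piP _ ru).2 => w /= wr.
  split; last by apply: mem_lspan; apply: map_f.
  by have [] : (T `&` I) w by rewrite TIr; apply: mem_lspan.
- by exists v.
move=> _ -> _ [_ [u [Tu Iu] <-] <-]; exists (comm x u); last by rewrite ad_subquot_pi.
by split; [apply: Tx | apply: I_ideal].
Qed.

Lemma ad_subquot_h_locfin (cs : seq (M -> M)) : (forall c, c \in cs -> h c) ->
  (forall D, h D -> exists c i, [/\ lspan [set` cs] c, I i & D = c + i]) ->
  locfin [set ad_subquot D | D in h].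
Proof.
move=> csh hcs; apply: (@locfin_sub _ _ (lspan (brackets X))).
  by move=> _ [D hD <-]; apply: ad_subquot_span.
apply: (@locfin_brackets _ _ _ _ (map ad_subquot cs)) => //.
- by move=> _ [x xx <-]; apply: ad_subquot_linear; apply: h_xs.
- by move=> _ [x xx <-]; apply: ad_subquot_locfin.
move=> _ /brackets_ad_subquot_inv[D hD ->].
have [c [i [cc Ii DE]]] := hcs D hD.
have sS := subspace_lspan [set` map ad_subquot cs].
have [hc Uc] : h c /\ lspan [set` map ad_subquot cs] (ad_subquot c).
  apply: (lspan_lin_on sh sS ad_subquot_add _ cc) => d /= dcs.
  by split; [apply: csh | apply: mem_lspan; apply: map_f].
have -> : D = 1 *: c + i by rewrite scale1r.
rewrite ad_subquot_add //; last exact: Ih.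
by rewrite (ad_subquot0 Ii); apply: (subspaceP _ sS) => //; apply: subspace0.
Qed.

Lemma decompose_seq (cs ds : seq (M -> M)) :
  (forall D, h D -> exists c i, [/\ lspan [set` cs] c, I i & D = c + i]) ->
  (forall d, d \in ds -> h d) ->
  exists es : seq (M -> M), (forall e, e \in es -> I e) /\
    forall d, d \in ds -> exists c e, [/\ lspan [set` cs] c, e \in es & d = c + e].
Proof.
move=> hcs; elim: ds => [|d ds IH] dsh; first by exists [::].
have [|es [esI esP]] := IH; first by move=> e eds; apply: dsh; rewrite inE eds orbT.
have [c [i [cc Ii dE]]] := hcs d (dsh d (mem_head _ _)).
exists (i :: es); split=> e; first by rewrite inE => /orP[/eqP ->|/esI].
rewrite inE => /orP[/eqP ->|/esP [c' [e' [? ? ->]]]].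
  by exists c, i; rewrite mem_head.
by exists c', e'; split=> //; rewrite inE orbC; apply/orP; left.
Qed.

(** Modulo the span of [cs], finitely many elements [es] of [I] record
    the generators and the brackets of the [cs]; together with the [h]-submodule
    of [I / I'] that they generate, which is finite-dimensional, the [cs]
    already span a subalgebra containing the generators. *)
Lemma finite_codim_derived (cs : seq (M -> M)) : (forall c, c \in cs -> h c) ->
  (forall D, h D -> exists c i, [/\ lspan [set` cs] c, I i & D = c + i]) ->
  exists cs' : seq (M -> M), (forall c, c \in cs' -> h c) /\
    forall D, h D -> exists c i, [/\ lspan [set` cs'] c, I' i & D = c + i].
Proof.
move=> csh hcs; set C := lspan [set` cs].
have sC : subspace C by apply: subspace_lspan.
have Ch : C `<=` h by apply: lspan_min.
have [|es [esI esP]] := @decompose_seq cs (xs ++ [seq comm c d | c <- cs, d <- cs]) hcs.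
  move=> d; rewrite mem_cat => /orP[/h_xs //|/allpairsP [[c c'] /= [cc cc' ->]]].
  by apply: h_comm; apply: csh.
have [|U [sU [us Uus] Ues UD]] :=
    locfin_seq (map pi es) _ (ad_subquot_h_locfin csh hcs).
  by move=> _ [D hD <-]; apply: ad_subquot_linear.
(* [B] is the preimage in [I] of a finite-dimensional [h]-submodule [U] of
   [I / I'] that contains the classes of the [es]. *)
pose B : set (M -> M) := [set v | I v /\ U (pi v)].
have sB : subspace B.
  split.
    split; first exact: subspace0.
    by rewrite (_ : pi 0 = 0); [apply: subspace0 | apply/subquot_pi0 => //; apply: subspace0].
  move=> k u v [Iu Uu] [Iv Uv]; split; first exact: (subspaceP _ sI).
  by rewrite piP //; apply: (subspaceP _ sU).
have B_ideal D b : h D -> B b -> B (comm D b).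
  move=> hD [Ib Ub]; split; first exact: I_ideal.
  by rewrite -ad_subquot_pi //; apply: UD => //; exists D.
pose H := [set v | exists c b, [/\ C c, B b & v = c + b]].
have sH : subspace H by apply: subspace_sum.
have dsH d : d \in xs ++ [seq comm c d | c <- cs, d <- cs] -> H d.
  move=> /esP [c [e [cc ees ->]]]; exists c, e; split=> //; split; first exact: esI.
  by apply: Ues; apply: map_f.
have CCH c d : C c -> C d -> H (comm c d).
  move=> Cc Cd; have dL := hL (Ch d Cd).
  apply: (@lspan_lin _ _ _ (comm^~ d) _ _ _ sH) Cc; first exact: comm_linear_l.
  move=> {}c /= cc; have cL := hL (csh c cc).
  apply: (@lspan_lin _ _ _ (comm c) _ _ _ sH) Cd; first exact: comm_linear_r.
  by move=> e ec; apply: dsH; rewrite mem_cat allpairs_f ?orbT.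
have BH b : B b -> H b by exists 0, b; rewrite add0r; split=> //; apply: subspace0.
have Hh v : H v -> h v.
  by move=> [c [b [/Ch hc [/Ih hb _] ->]]]; apply: (subspaceD sh).
have HH u v : H u -> H v -> H (comm u v).
  move=> [c [b [Cc Bb ->]]] Hv; have hv := Hh v Hv.
  have bh : h b by case: Bb => /Ih.
  rewrite -[c]scale1r (comm_linear_l (hL hv)) scale1r; apply: (subspaceD sH).
    move: Hv => [c' [b' [Cc' Bb' ->]]].
    rewrite (linD (comm_linear_r (hL (Ch c Cc)))); apply: (subspaceD sH); first exact: CCH.
    by apply: BH; apply: B_ideal => //; apply: Ch.
  rewrite commC -scaleN1r; apply: (subspaceZ _ sH).
  by apply: BH; apply: B_ideal.
have hH : h `<=` H.
  rewrite h_gen; apply: lspan_min => // z.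
  have xsH x : x \in xs -> H x by move=> xx; apply: dsH; rewrite mem_cat xx.
  by elim=> {z} [x /= /xsH //|x z /xsH Hx _ Hz]; apply: HH.
exists (cs ++ map (@subquot_val _ _ _ _ sI sI') us); split.
  move=> c; rewrite mem_cat => /orP[/csh //|/mapP [q _ ->]].
  by apply: Ih; apply: subquot_valP.
move=> D /hH [c [b [Cc [Ib]]]]; rewrite Uus => ub ->.
set vs := map (@subquot_val _ _ _ _ sI sI') us.
have sV := subspace_lspan [set` vs].
have [s [Is vss pis]] : exists s, [/\ I s, lspan [set` vs] s & pi s = pi b].
  apply: (@lspan_min _ _ [set` us] [set q | exists s, [/\ I s, lspan [set` vs] s & pi s = q]]) ub.
    split.
      exists 0; split; try exact: subspace0.
      by apply/subquot_pi0 => //; apply: subspace0.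
    move=> k _ _ [s [Is vs_s <-]] [r [Ir vr <-]]; exists (k *: s + r).
    by split; [apply: (subspaceP _ sI) | apply: (subspaceP _ sV) | apply: piP].
  move=> q /= qu; exists (subquot_val q); split; first exact: subquot_valP.
    by apply: mem_lspan; apply: map_f.
  exact: subquot_valK.
exists (c + s), (b - s); split.
- apply: (subspaceD (subspace_lspan _)).
    by apply: lspan_mono Cc => x /= xc; rewrite mem_cat xc.
  by apply: lspan_mono vss => x /= xv; rewrite mem_cat xv orbT.
- by apply/(subquot_pi_eq sI sI').
by rewrite -addrA (addrC b) addNKr.
Qed.

End DerivedStep.

(** * Derivations of a finitely generated algebra *)

Section Derivations.
Variables (K : fieldType) (A : comPzAlgType K).
Implicit Types (D E : A -> A) (U : set A) (s t : seq A).

Lemma Der_linear D : @Der K A D -> linear D.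
Proof. by case. Qed.

Lemma subspace_Der : subspace (@Der K A).
Proof.
split.
  by split=> [|a b]; [exact: linear_0 | rewrite -[RHS]/(0 * b + a * 0) mul0r mulr0 addr0].
move=> k D E [DL DM] [EL EM]; split; first exact: linear_comb.
move=> a b; rewrite !fctE DM EM !algmapE mulrDl !mulrDr !mulrA.
by rewrite (mulrC a (algmap A k : A)) addrACA.
Qed.

Lemma Der_lie D E : Der D -> Der E -> @Der K A (lie D E).
Proof.
move=> [DL DM] [EL EM]; split; first exact: linear_comm.
move=> a b; rewrite /lie EM DM (linD DL) (linD EL) !DM !EM mulrBl mulrBr.
set p := D (E a) * b; set q := a * D (E b); set r := E a * D b; set l := D a * E b.
set u := E (D a) * b; set v := a * E (D b).
by rewrite !opprD !addrA [LHS](ACl (1*5*4*8*((2*7)*(3*6)))%AC) /= !subrr !addr0.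
Qed.

Lemma Der_one D : @Der K A D -> D 1 = 0.
Proof.
move=> [_ DM]; have := DM 1 1; rewrite !mulr1 mul1r => e.
by apply: (addrI (D 1)); rewrite addr0 -e.
Qed.

Lemma Der_eq D E s : smallest (@subalgebra K A) [set` s] = setT ->
  Der D -> Der E -> (forall p, p \in s -> D p = E p) -> D = E.
Proof.
move=> sA DD DE eDE; apply/funext => a.
have [DL DM] := DD; have [EL EM] := DE.
have : smallest (@subalgebra K A) [set` s] a by rewrite sA.
apply: (@smallest_sub _ _ [set` s] [set a | D a = E a]) => //; split.
- by rewrite /= !Der_one.
- split; first by rewrite /= !lin0.
  by move=> k u v /= Du Dv; rewrite DL EL Du Dv.
- by move=> x y /= Dx Dy; rewrite DM EM Dx Dy.
Qed.

Lemma finite_dim_Der (W : set (A -> A)) s t :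
  smallest (@subalgebra K A) [set` s] = setT -> subspace W -> W `<=` @Der K A ->
  (forall D p, W D -> p \in s -> lspan [set` t] (D p)) -> finite_dim W.
Proof.
move=> sA sW WD Wt; have [us [usW usP]] := finite_mod_values sW Wt.
apply: (finite_dim_sub (t := us)) => // D /[dup] /WD DD /usP [E usE DE].
have WE : W E by apply: lspan_min usE.
by rewrite (Der_eq sA DD (WD E WE) DE).
Qed.

(** A derivation is determined by its values on the generators, and those of the
    members of [L] stay in a finite-dimensional space [U] stable under [L]. *)
Lemma finite_dim_locfin (L : set (A -> A)) : @finitely_generated K A ->
  lie_subalgebra L -> locally_finite L -> finite_dim L.
Proof.
move=> [s sA] [LD sL _] Llf.
have [|U [sU [t Ut] Us UD]] := @locfin_seq K A L s _ Llf; first by move=> D /LD [].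
by apply: (finite_dim_Der (t := t) sA sL LD) => D p LDD ps; rewrite -Ut; apply: UD => //; apply: Us.
Qed.

(** Take an [x]-stable finite-dimensional [U] that contains generators of [A],
    and another one [U'] that contains [D U]: the derivations that map [U] into
    [U'] form a finite-dimensional space stable under the bracket with [x]. *)
Lemma ad_locally_finite (x D : A -> A) : @finitely_generated K A ->
  @Der K A x -> locally_finite [set x] -> @Der K A D ->
  exists T : set (A -> A),
    [/\ subspace T, finite_dim T, T D & forall E, T E -> T (lie x E)].
Proof.
move=> [s sA] Dx xlf DD.
have xL E : [set x] E -> linear E by move=> ->; case: Dx.
have [U [sU [t Ut] Us Ux]] := locfin_seq s xL xlf.
have [U' [sU' [t' Ut'] U't U'x]] := locfin_seq (map D t) xL xlf.
pose T : set (A -> A) := [set E | Der E /\ forall a, U a -> U' (E a)].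
have sT : subspace T.
  split.
    split; first exact: subspace0 subspace_Der.
    by move=> a _; apply: subspace0.
  move=> k E F [DE EU] [DF FU]; split; first exact: (subspaceP _ subspace_Der).
  by move=> a Ua; apply: (subspaceP _ sU'); [apply: EU | apply: FU].
exists T; split=> //.
- apply: (finite_dim_Der (t := t') sA sT) => [E [] //|E p [_ EU] /Us/EU].
  by rewrite Ut'.
- split=> // a; rewrite Ut => ta.
  apply: (lspan_lin (Der_linear DD) sU' _ ta) => b /= bt.
  by apply: U't; apply: map_f.
move=> E [DE EU]; split; first exact: Der_lie.
move=> a Ua; apply: (subspaceB sU'); first by apply: U'x => //; apply: EU.
by apply: EU; apply: Ux.
Qed.

End Derivations.

Lemma lie_generated_brackets (K : fieldType) (A : comPzAlgType K)
    (X Y h : set (A -> A)) :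
  lie_subalgebra h -> h = @lie_generated K A Y ->
  X `<=` h -> Y `<=` lspan X -> h = lspan (brackets X).
Proof.
move=> [hD sh hbr] hY Xh YX.
have XL x : X x -> linear x by move=> /Xh/hD [].
have bh : brackets X `<=` h by move=> z; elim=> {z} [x /Xh //|x z /Xh hx _ hz]; apply: hbr.
have lbh : lspan (brackets X) `<=` h by apply: lspan_min.
apply/seteqP; split=> //; rewrite {1}hY; apply: smallest_sub.
  split; [by move=> z /lbh/hD | exact: subspace_lspan | exact: brackets_closed].
by move=> y /YX; apply: lspan_mono => x; apply: brackets_gen.
Qed.

Theorem theorem4 (K : fieldType) (charK : [pchar K] =i pred0)
    (A : comPzAlgType K) (fgA : finitely_generated A)
    (n : nat) (hi : 'I_n -> set (A -> A)) (h : set (A -> A))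
    (hi_lie : forall i, lie_subalgebra (hi i))
    (hi_lf : forall i, locally_finite (hi i))
    (h_lie : lie_subalgebra h)
    (h_solvable : lie_solvable h)
    (h_gen : h = lie_generated (\bigcup_i hi i)) :
  finite_dim h /\ locally_finite h.
Proof.
have [hD sh hbr] := h_lie.
have hL D : h D -> linear D by move/hD/Der_linear.
have hih i : hi i `<=` h.
  by move=> x hx; rewrite h_gen; apply: sub_gen_smallest; exists i.
have [s sP] := choice (fun i => finite_dim_locfin fgA (hi_lie i) (hi_lf i)).
pose xs := flatten [seq s i | i <- enum 'I_n].
have xsP x : x \in xs -> exists i, hi i x.
  by move=> /flatten_mapP [i _ xi]; exists i; rewrite sP; apply: mem_lspan.
have hE : h = lspan (brackets [set` xs]).
  apply: (lie_generated_brackets h_lie h_gen) => [x /= /xsP [i /hih] //|].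
  move=> x [i _]; rewrite sP; apply: lspan_mono => y /= ys.
  by apply/flatten_mapP; exists i; rewrite ?mem_enum.
have xs_lf x : x \in xs -> locally_finite [set x].
  by move=> /xsP [i ix]; apply: (@locfin_sub K A (hi i)); [move=> _ -> | exact: hi_lf].
have ad_lf x D : x \in xs -> h D -> exists T : set (A -> A),
    [/\ subspace T, finite_dim T, T D & forall E, T E -> T (comm x E)].
  move=> xx hDD; apply: ad_locally_finite => //; [|exact: xs_lf|exact: hD].
  by have [i /hih/hD] := xsP x xx.
(* Every term of the derived series is an ideal of finite codimension in [h]. *)
have step k : [/\ subspace (iter k (@derived K A) h), iter k (@derived K A) h `<=` h,
    (forall D E, h D -> iter k (@derived K A) h E -> iter k (@derived K A) h (comm D E)) &
    exists cs : seq (A -> A), (forall c, c \in cs -> h c) /\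
    forall D, h D -> exists c i,
      [/\ lspan [set` cs] c, iter k (@derived K A) h i & D = c + i]].
  elim: k => [|k [sI Ih I_ideal [cs [csh csP]]]].
    split=> //; exists [::]; split=> // D hDD; exists 0, D; rewrite add0r.
    by split=> //; apply: subspace0 (subspace_lspan _).
  split; first exact: subspace_lspan.
  - by move=> D /(derived_sub sI Ih I_ideal) /Ih.
  - exact: derived_ideal.
  exact: (finite_codim_derived charK hL sh hbr hE ad_lf sI Ih I_ideal csh csP).
have [m hm] := h_solvable; have [_ _ _ [cs [csh csP]]] := step m.
have hcs : h `<=` lspan [set` cs].
  by move=> D /csP [c [i []]]; rewrite hm => cc -> ->; rewrite addr0.
split; first exact: (finite_dim_sub sh hcs).
rewrite hE; apply: (@locfin_brackets K A [set` xs] _ cs charK) => //.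
  by move=> x /xsP [i /hih/hL].
by move=> z zX; apply: hcs; rewrite hE; apply: sub_lspan.
Qed.
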